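(* Let $m,n\in\mathbb{N}$ (natural numbers, including $0$) and let $\psi\in\mathsf{MF}$. If $\mathbf{N}^+\mathbf{A}_{m,n}\vdash\psi$, then $\psi$ is valid on every $(m,n)$-accessible $\mathbf{N}$-frame.
   Context: Language: modal formulae are built from propositional variables (the set $\mathsf{PropVar}$), the constant $\bot$, $\neg$, $\lor$, and $\Box$; $\varphi\to\psi$ abbreviates $\neg\varphi\lor\psi$. $\mathsf{MF}$ is the set of all formulae, $\Box^0\varphi=\varphi$ and $\Box^{k+1}\varphi=\Box\Box^k\varphi$. Logics: $\mathbf{N}$ has as axioms all propositional tautologies in the modal language and as rules modus ponens and necessitation (from $\varphi$ infer $\Box\varphi$). $\mathbf{N}\mathbf{A}_{m,n}$ is $\mathbf{N}$ plus the axiom scheme $\Box^n\varphi\to\Box^m\varphi$ (all $\varphi\in\mathsf{MF}$). $\mathbf{N}^+\mathbf{A}_{m,n}$ is $\mathbf{N}\mathbf{A}_{m,n}$ plus the rule $\mathrm{Ros}^\Box$: from $\neg\Box\varphi$ infer $\neg\Box\Box\varphi$. Semantics: an $\mathbf{N}$-frame is $(W,\{\prec_\varphi\}_{\varphi\in\mathsf{MF}})$ with $W$ a non-empty set and $\prec_\varphi$ a binary relation on $W$ for each $\varphi\in\mathsf{MF}$. An $\mathbf{N}$-model based on it adds a valuation $V:W\times\mathsf{PropVar}\to\{0,1\}$. Satisfaction: $w\Vdash p$ iff $V(w,p)=1$; $w\nVdash\bot$; $\neg,\lor$ as usual; $w\Vdash\Box\varphi$ iff $w'\Vdash\varphi$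 for every $w'\in W$ with $w\prec_\varphi w'$. A formula is valid in a model if it is satisfied at every $w\in W$, and valid on a frame if it is valid in every model based on it. Accessibility: define $x\prec_\varphi^0 y$ iff $x=y$, and for $k\ge1$, $x\prec_\varphi^k y$ iff there is $w\in W$ with $x\prec_{\Box^{k-1}\varphi}w$ and $w\prec_\varphi^{k-1}y$. A frame is $(m,n)$-accessible if for all $\varphi\in\mathsf{MF}$ and $x,y\in W$, $x\prec_\varphi^m y$ implies $x\prec_\varphi^n y$. *)

(* Defs.v *)
From Stdlib Require Import Bool.

Set Implicit Arguments.
Unset Strict Implicit.

Declare Scope modal_scope.
Delimit Scope modal_scope with MF.

Inductive MF (PropVar : Type) : Type :=
| Var : PropVar -> MF PropVar
| Bot : MF PropVar
| Neg : MF PropVar -> MF PropVar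
| Or  : MF PropVar -> MF PropVar -> MF PropVar
| Box : MF PropVar -> MF PropVar.

Arguments Bot {PropVar}.
Bind Scope modal_scope with MF.

Definition Imp (PropVar : Type) (phi psi : MF PropVar) : MF PropVar :=
  Or (Neg phi) psi.

Definition boxn (PropVar : Type) (k : nat) (phi : MF PropVar) : MF PropVar :=
  Nat.iter k (@Box PropVar) phi.

Notation "~~ phi" := (Neg phi) (at level 35, right associativity) : modal_scope.
Notation "[] phi" := (Box phi) (at level 35, right associativity) : modal_scope.
Notation "phi --> psi" := (Imp phi psi)
  (at level 55, right associativity) : modal_scope.

(* Truth-functional evaluation: variables and boxed formulae are both treated
   as propositional atoms, with truth values read off from [a]. *)
Fixpoint prop_eval (PropVar : Type) (a : MF PropVar -> bool) (phi : MF PropVar)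
    : bool :=
  match phi with
  | Var _ => a phi
  | Bot => false
  | Neg psi => negb (prop_eval a psi)
  | Or psi chi => prop_eval a psi || prop_eval a chi
  | Box _ => a phi
  end.

Definition tautology (PropVar : Type) (phi : MF PropVar) : Prop :=
  forall a : MF PropVar -> bool, prop_eval a phi = true.

(* [NplusA m n phi] : phi is a theorem of N^+A_{m,n}. *)
Inductive NplusA (PropVar : Type) (m n : nat) : MF PropVar -> Prop :=
| NplusA_taut : forall phi, tautology phi -> NplusA m n phi
| NplusA_acc : forall phi, NplusA m n (boxn n phi --> boxn m phi)%MF
| NplusA_mp : forall phi psi,
    NplusA m n (phi --> psi)%MF -> NplusA m n phi -> NplusA m n psi
| NplusA_nec : forall phi, NplusA m n phi -> NplusA m n ([] phi)%MF
| NplusA_ros : forall phi,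
    NplusA m n (~~ [] phi)%MF -> NplusA m n (~~ [] [] phi)%MF.

Record NFrame (PropVar : Type) : Type := {
  world :> Type;
  world_nonempty : inhabited world;
  rel : MF PropVar -> world -> world -> Prop
}.

Arguments rel {PropVar} F phi w w' : rename.

(* The model based on [F] with valuation [V]. *)
Fixpoint sat (PropVar : Type) (F : NFrame PropVar) (V : F -> PropVar -> bool)
    (w : F) (phi : MF PropVar) : Prop :=
  match phi with
  | Var p => V w p = true
  | Bot => False
  | Neg psi => ~ sat V w psi
  | Or psi chi => sat V w psi \/ sat V w chi
  | Box psi => forall w' : F, rel F psi w w' -> sat V w' psi
  end.

Definition valid_model (PropVar : Type) (F : NFrame PropVar)
    (V : F -> PropVar -> bool) (phi : MF PropVar) : Prop :=
  forall w : F, sat V w phi.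

Definition valid_frame (PropVar : Type) (F : NFrame PropVar)
    (phi : MF PropVar) : Prop :=
  forall V : F -> PropVar -> bool, valid_model V phi.

Fixpoint reln (PropVar : Type) (F : NFrame PropVar) (k : nat)
    (phi : MF PropVar) (x y : F) : Prop :=
  match k with
  | 0 => x = y
  | S k' => exists w : F, rel F (boxn k' phi) x w /\ reln k' phi w y
  end.

Definition accessible (PropVar : Type) (m n : nat) (F : NFrame PropVar) : Prop :=
  forall (phi : MF PropVar) (x y : F), reln m phi x y -> reln n phi x y.

(* Main.v *)
Require Import Defs.
From Stdlib Require Import Bool ClassicalEpsilon.

(** The only rule that can fail to preserve validity is Ros, and it does
    preserve it at [~ [] phi] as soon as the relation of [[] phi] is serial.
    This seriality is not a consequence of accessibility for every [phi]; it has
    to be read off the provability of [~ [] phi].  When [m > 0] or [n = 0], the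
    frame with empty relations is accessible and satisfies every boxed formula,
    so no [~ [] phi] is provable.  When [m = 0] and [n = k + 1], there is a
    two-world accessible frame whose second world sees nothing through [phi]
    unless [phi] is of the form [[]^k chi]; hence [~ [] phi] is provable only for
    such [phi], and then [[] phi = []^k [] chi], whose relation is serial in every
    accessible frame because each world [x] starts a path from [x] to [x] whose
    first step is along that relation. *)

Lemma prop_eval_sat (PropVar : Type) (F : NFrame PropVar)
    (V : F -> PropVar -> bool) (w : F) (a : MF PropVar -> bool) :
  (forall phi, a phi = true <-> sat V w phi) ->
  forall phi, prop_eval a phi = true <-> sat V w phi.
Proof.
  intros Ha phi.
  induction phi as [p | | phi IH | phi1 IH1 phi2 IH2 | phi _]; cbn [prop_eval].
  - apply Ha.
  - split; [discriminate | intros [ ]].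
  - rewrite negb_true_iff, <- not_true_iff_false. cbn [sat]. tauto.
  - rewrite orb_true_iff. cbn [sat]. tauto.
  - apply Ha.
Qed.

Lemma sat_tautology (PropVar : Type) (F : NFrame PropVar)
    (V : F -> PropVar -> bool) (w : F) (phi : MF PropVar) :
  tautology phi -> sat V w phi.
Proof.
  intros Ht.
  pose (a := fun chi =>
    if excluded_middle_informative (sat V w chi) then true else false).
  apply (prop_eval_sat _ F V w a); [| apply Ht].
  intros chi. unfold a.
  destruct (excluded_middle_informative (sat V w chi)); split; easy.
Qed.

Lemma sat_boxn (PropVar : Type) (F : NFrame PropVar)
    (V : F -> PropVar -> bool) (k : nat) (phi : MF PropVar) (x : F) :
  sat V x (boxn k phi) <-> forall y, reln k phi x y -> sat V y phi.
Proof.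
  revert x. induction k as [| k IH]; intros x; cbn.
  - split; [intros H y <-; exact H | auto].
  - split.
    + intros H y (w & Hxw & Hwy). exact (proj1 (IH w) (H w Hxw) y Hwy).
    + intros H w Hxw. apply (IH w). eauto.
Qed.

Lemma box_boxn (PropVar : Type) (k : nat) (phi : MF PropVar) :
  Box (boxn k phi) = boxn k (Box phi).
Proof.
  induction k as [| k IH]; cbn; [reflexivity | now f_equal].
Qed.

(** Seriality is asked only where [Neg (Box phi)] is both provable and valid in the model: validity
    settles it on the two concrete frames below, provability on an arbitrary frame. *)
Lemma sound_of_serial (PropVar : Type) (m n : nat) (F : NFrame PropVar)
    (V : F -> PropVar -> bool) :
  accessible m n F ->
  (forall phi, NplusA m n (Neg (Box phi)) -> valid_model V (Neg (Box phi)) ->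
     forall w : F, exists w', rel F (Box phi) w w') ->
  forall psi, NplusA m n psi -> valid_model V psi.
Proof.
  intros Hacc Hser psi Hpsi.
  induction Hpsi as [phi Ht | phi | phi psi _ IHimp _ IHphi | phi _ IH
                    | phi Hphi IH]; intros w.
  - now apply sat_tautology.
  - cbn [Imp sat]. destruct (classic (sat V w (boxn n phi))) as [H | H].
    + right. apply sat_boxn. intros y Hy.
      apply (proj1 (sat_boxn _ F V n phi w) H), Hacc, Hy.
    + now left.
  - destruct (IHimp w) as [H | H]; [destruct (H (IHphi w)) | exact H].
  - intros w' _. apply IH.
  - intros H. destruct (Hser phi Hphi IH w) as [w' Hw'].
    exact (IH w' (H w' Hw')).
Qed.

Definition empty_frame (PropVar : Type) : NFrame PropVar :=
  {| world := unit; world_nonempty := inhabits tt;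
     rel := fun _ _ _ => False |}.

Lemma not_provable_neg_box (PropVar : Type) (m n : nat) (phi : MF PropVar) :
  accessible m n (empty_frame PropVar) -> ~ NplusA m n (Neg (Box phi)).
Proof.
  intros Hacc Hphi.
  assert (Hbox : forall chi : MF PropVar,
             ~ valid_model (F := empty_frame PropVar) (fun _ _ => true)
                 (Neg (Box chi))).
  { intros chi H. apply (H tt). intros w' [ ]. }
  apply (Hbox phi).
  apply (sound_of_serial _ m n); [exact Hacc | | exact Hphi].
  (* No such formula is valid in this model, so seriality holds vacuously. *)
  intros chi _ H. destruct (Hbox chi H).
Qed.

Definition two_world_frame (PropVar : Type) (k : nat) : NFrame PropVar :=
  {| world := bool; world_nonempty := inhabits true;
     rel := fun phi x _ => x = true \/ exists chi, phi = boxn k chi |}.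

Lemma reln_two_world_frame (PropVar : Type) (k j : nat) (phi : MF PropVar)
    (y : two_world_frame PropVar k) :
  reln (F := two_world_frame PropVar k) (S j) phi true y.
Proof.
  induction j as [| j IH].
  - exists y. split; [now left | reflexivity].
  - exists true. split; [now left | exact IH].
Qed.

(** The first of the [S k] steps is along [boxn k phi], whose relation is total. It goes to [true],
    from where the remaining steps can end anywhere; if [k = 0], it must itself land on [x]. *)
Lemma accessible_two_world_frame (PropVar : Type) (k : nat) :
  accessible 0 (S k) (two_world_frame PropVar k).
Proof.
  intros phi x y Hxy. cbn in Hxy. subst y. destruct k as [| k].
  - exists x. split; [right; now exists phi | reflexivity].
  - exists true. split; [right; now exists phi | apply reln_two_world_frame].
Qed.

Lemma provable_neg_box_inv (PropVar : Type) (k : nat) (phi : MF PropVar) :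
  NplusA 0 (S k) (Neg (Box phi)) -> exists chi, phi = boxn k chi.
Proof.
  intros Hphi.
  assert (Hbox : forall chi : MF PropVar,
             valid_model (F := two_world_frame PropVar k) (fun _ _ => true)
               (Neg (Box chi)) ->
             exists theta, chi = boxn k theta).
  { intros chi H. apply NNPP. intros Hn. apply (H false).
    intros w' [Hw | Hw]; [discriminate | contradiction]. }
  apply Hbox.
  apply (sound_of_serial _ 0 (S k));
    [apply accessible_two_world_frame | | exact Hphi].
  intros chi _ H w. destruct (Hbox chi H) as [theta ->].
  (* [Box chi] is [boxn k (Box theta)], so its relation is total on this frame. *)
  exists true. right. exists (Box theta). apply box_boxn.
Qed.

Lemma serial_of_provable_neg_box (PropVar : Type) (m n : nat)
    (F : NFrame PropVar) (phi : MF PropVar) :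
  accessible m n F -> NplusA m n (Neg (Box phi)) ->
  forall w : F, exists w', rel F (Box phi) w w'.
Proof.
  intros Hacc Hphi w. destruct m as [| m].
  - destruct n as [| k].
    + exfalso. revert Hphi. apply not_provable_neg_box.
      intros chi x y H. exact H.
    + destruct (provable_neg_box_inv _ k phi Hphi) as [chi ->].
      destruct (Hacc (Box chi) w w eq_refl) as (w' & Hw' & _).
      exists w'. now rewrite box_boxn.
  (* The empty frame has no path of length [S m], so accessibility is vacuous. *)
  - exfalso. revert Hphi. apply not_provable_neg_box.
    intros chi x y (w' & [ ] & _).
Qed.

Theorem theorem4p4 (PropVar : Type) (m n : nat) (psi : MF PropVar) :
  NplusA m n psi ->
  forall F : NFrame PropVar, accessible m n F -> valid_frame F psi.
Proof.
  intros Hpsi F Hacc V.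
  apply (sound_of_serial _ m n); [exact Hacc | | exact Hpsi].
  intros phi Hphi _. now apply (serial_of_provable_neg_box _ m n).
Qed.
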